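(* Let $Z$ be a bounded metric space with finite capacity dimension $\operatorname{cdim}Z=n<\infty$. Then there exist metric trees $T_a$, $a\in A$, $|A|=n+1$, and a quasi-isometric embedding $f:\operatorname{Co}(Z)\to\prod_{a\in A}T_a$.
   Context: Hyperbolic cone: for a bounded metric space $Z$ with $\operatorname{diam}Z>0$, put $\mu=\pi/\operatorname{diam}Z$. $\operatorname{Co}(Z)=Z\times[0,\infty)/Z\times\{0\}$, with metric: for $x=(z,t)$, $x'=(z',t')$, $|xx'|$ is the length of the side $\bar x\bar x'$ of a triangle $\bar o\bar x\bar x'$ in the hyperbolic plane $\mathrm H^2$ with $|\bar o\bar x|=t$, $|\bar o\bar x'|=t'$ and angle $\mu|zz'|$ at $\bar o$. If $Z$ is a point, $\operatorname{Co}(Z)=[0,\infty)$. A map $f$ is a quasi-isometric embedding if $\frac1\Lambda|xx'|-\sigma\le|f(x)f(x')|\le\Lambda|xx'|+\sigma$ for some $\Lambda\ge1,\sigma\ge0$. Metric tree: geodesic real tree. Products carry the $\ell^2$ product metric. Capacity dimension: with $\operatorname{mesh}(\mathcal U)=\sup_{U\in\mathcal U}\operatorname{diam}U$, an open covering $\mathcal U$ being $(m+1)$-colored if it is a union of $m+1$ subfamilies each consisting of pairwise disjoint sets, and Lebesgue number $L(\mathcal U)=\inf_{z}\min\{\sup_{U\in\mathcal U}\operatorname{dist}(z,Z\setminus U),\operatorname{mesh}\mathcal U\}$, $\operatorname{cdim}(Z)$ is the least integer $m\ge0$ for which there is $\delta>0$ such that for all sufficiently small $\tau>0$ there is an open $(m+1)$-colored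 covering $\mathcal U$ of $Z$ with $\operatorname{mesh}(\mathcal U)\le\tau$ and $L(\mathcal U)\ge\delta\tau$. *)

(* Defs.v *)
From Stdlib Require Import Reals.
From mathcomp Require Import ssreflect ssrfun ssrbool eqtype ssrnat seq fintype bigop.
From Coquelicot Require Import Coquelicot.

Open Scope R_scope.

Definition is_metric {X : Type} (d : X -> X -> R) : Prop :=
  (forall x y, 0 <= d x y) /\
  (forall x y, d x y = 0 <-> x = y) /\
  (forall x y, d x y = d y x) /\
  (forall x y z, d x z <= d x y + d y z).

Definition met_bounded {X : Type} (d : X -> X -> R) : Prop :=
  exists M : R, forall x y, d x y <= M.

(** Diameter of a subset (sup of distances, in Rbar; empty set gives -oo). *)
Definition diam_set {X : Type} (d : X -> X -> R) (S : X -> Prop) : Rbar :=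
  Rbar_lub (fun v => exists x y, S x /\ S y /\ v = Finite (d x y)).

Definition diam {X : Type} (d : X -> X -> R) : R := real (diam_set d (fun _ => True)).

(** Hyperbolic cone. Co(Z) = Z x [0,oo) / Z x {0}: the apex [None] is the
    collapsed class Z x {0}; [Some (z, t)] is (z,t) with t > 0. *)
Definition posR := {t : R | 0 < t}.
Definition cone (Z : Type) : Type := option (Z * posR).

Definition acosh (x : R) : R := ln (x + sqrt (x * x - 1)).

(** Length of the side opposite to the angle th in a hyperbolic triangle with
    adjacent sides a, b (hyperbolic law of cosines, curvature -1). *)
Definition hyp_side (a b th : R) : R :=
  acosh (cosh a * cosh b - sinh a * sinh b * cos th).

Definition cone_dist {Z : Type} (d : Z -> Z -> R) (x y : cone Z) : R :=
  let mu := PI / diam d in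
  match x, y with
  | None, None => 0
  | None, Some (_, t) => proj1_sig t
  | Some (_, t), None => proj1_sig t
  | Some (z, t), Some (z', t') =>
      hyp_side (proj1_sig t) (proj1_sig t') (mu * d z z')
  end.

Definition geodesic_segment {T : Type} (dT : T -> T -> R) (x y : T) (g : R -> T) : Prop :=
  g 0 = x /\ g (dT x y) = y /\
  forall s t, 0 <= s <= dT x y -> 0 <= t <= dT x y -> dT (g s) (g t) = Rabs (s - t).

Definition arc {T : Type} (dT : T -> T -> R) (x y : T) (a : R -> T) : Prop :=
  a 0 = x /\ a 1 = y /\
  (forall s, 0 <= s <= 1 -> forall eps, 0 < eps -> exists del, 0 < del /\
      forall s', 0 <= s' <= 1 -> Rabs (s - s') < del -> dT (a s) (a s') < eps) /\
  (forall s s', 0 <= s <= 1 -> 0 <= s' <= 1 -> a s = a s' -> s = s').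

(** A real tree: any two points are joined by a unique arc, and this arc is a
    geodesic segment. Here: a geodesic segment exists, and every arc between the
    same points has the same image as it. *)
Definition metric_tree {T : Type} (dT : T -> T -> R) : Prop :=
  is_metric dT /\
  forall x y, exists g, geodesic_segment dT x y g /\
    forall a, arc dT x y a ->
      forall p, (exists s, 0 <= s <= 1 /\ a s = p) <->
                (exists s, 0 <= s <= dT x y /\ g s = p).

Definition prod_dist {k : nat} (T : 'I_k -> Type) (dT : forall a, T a -> T a -> R)
  (x y : forall a, T a) : R :=
  sqrt (\big[Rplus/0]_(a < k) (dT a (x a) (y a)) ^ 2).

Definition qi_embedding {X Y : Type} (dX : X -> X -> R) (dY : Y -> Y -> R) (f : X -> Y) : Prop :=
  exists Lam sig, 1 <= Lam /\ 0 <= sig /\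
    forall x x', dX x x' / Lam - sig <= dY (f x) (f x') /\
                 dY (f x) (f x') <= Lam * dX x x' + sig.

Definition open_set {X : Type} (d : X -> X -> R) (U : X -> Prop) : Prop :=
  forall x, U x -> exists r, 0 < r /\ forall y, d x y < r -> U y.

Definition open_covering {X : Type} (d : X -> X -> R) (F : (X -> Prop) -> Prop) : Prop :=
  (forall U, F U -> open_set d U) /\ (forall x, exists U, F U /\ U x).

(** F is (m+1)-colored: union of m+1 subfamilies, each consisting of pairwise
    disjoint sets (distinct members of a subfamily are disjoint). *)
Definition colored {X : Type} (m : nat) (F : (X -> Prop) -> Prop) : Prop :=
  exists Fk : nat -> (X -> Prop) -> Prop,
    (forall U, F U <-> exists k, (k <= m)%nat /\ Fk k U) /\
    (forall k U V, Fk k U -> Fk k V -> (exists x, U x /\ V x) -> forall x, U x <-> V x).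

Definition mesh {X : Type} (d : X -> X -> R) (F : (X -> Prop) -> Prop) : Rbar :=
  Rbar_lub (fun v => exists U, F U /\ v = diam_set d U).

(** dist(x, X \ U) (= +oo if U = X). *)
Definition dist_compl {X : Type} (d : X -> X -> R) (x : X) (U : X -> Prop) : Rbar :=
  Rbar_glb (fun v => exists y, ~ U y /\ v = Finite (d x y)).

Definition lebesgue_number {X : Type} (d : X -> X -> R) (F : (X -> Prop) -> Prop) : Rbar :=
  Rbar_glb (fun v => exists x, v =
     Rbar_min (Rbar_lub (fun s => exists U, F U /\ s = dist_compl d x U)) (mesh d F)).

Definition cdim_cond {X : Type} (d : X -> X -> R) (m : nat) : Prop :=
  exists delta, 0 < delta /\ exists tau0, 0 < tau0 /\
    forall tau, 0 < tau <= tau0 ->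
      exists F : (X -> Prop) -> Prop,
        open_covering d F /\ colored m F /\
        Rbar_le (mesh d F) (Finite tau) /\
        Rbar_le (Finite (delta * tau)) (lebesgue_number d F).

Definition cdim_eq {X : Type} (d : X -> X -> R) (n : nat) : Prop :=
  cdim_cond d n /\ forall m, (m < n)%nat -> ~ cdim_cond d m.

(* Main.v *)
Require Import Defs.
From Stdlib Require Import Reals.
From mathcomp Require Import ssreflect ssrfun ssrbool eqtype ssrnat seq fintype bigop.
From Coquelicot Require Import Coquelicot.
From Stdlib Require Import Lra Lia ClassicalEpsilon.
From Stdlib Require Import FunctionalExtensionality PropExtensionality Relations.
Set Bullet Behavior "Strict Subproofs".

(** Choose colored coverings at the scales tau_l = tau_0 r^l with r small against delta. For
    each color a and scale l let w_l^a : Z -> [0,1] be Lipschitz with constant 4 / (delta tau_l),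
    supported well inside the members of color a, and equal to 1 for some color at each point.
    The height h_a(z,k) = sum_(l<k) w_l^a(z) replaces the radial coordinate k. Call (z,k) and
    (z',k') linked at threshold s if for some m <= k, k' one has d(z,z') <= tau_m and
    h_a(z,m), h_a(z',m) >= s; the supremum G_a of the thresholds at which two points are joined
    by a chain of links is ultrametric, hence is the Gromov product of a map into a real tree.
    The Lipschitz bound gives the upper estimate for the tree distances. For the lower one,
    a chain of points active at levels >= j with steps below the next scale of these levels
    moves by at most 2 tau_j, by induction on the number of levels; so G_a <= h_a(z,j) + const
    once d(z,z') > 2 tau_j, and summing over the colors recovers the radial coordinate since
    each level is seen by some color. No nesting of the coverings is needed. On the cone side,
    the law of cosines gives t + t' - 2q up to a constant, e^(-q) being the scale of the angle. *)

(** * Real trees from ultrametric Gromov products *)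

(** Gromov's 0-hyperbolicity: of the three ways to pair four points, the two largest sums agree. *)
Definition four_point {T : Type} (d : T -> T -> R) : Prop :=
  forall u v w p, d u w + d v p <= Rmax (d u v + d w p) (d v w + d u p).

(** By the four-point condition, lying on the same side of [p] is an equivalence relation on the
    complement of [p], with open classes. A path avoiding [p] stays in one class, while the
    betweenness hypothesis separates its ends. *)
Lemma path_hits_between {T : Type} (d : T -> T -> R) (a : R -> T) (lo hi : R) (p : T) :
  is_metric d -> four_point d -> lo <= hi ->
  (forall s, lo <= s <= hi -> forall eps, 0 < eps -> exists del, 0 < del /\
      forall s', lo <= s' <= hi -> Rabs (s - s') < del -> d (a s) (a s') < eps) ->
  d (a lo) p + d p (a hi) = d (a lo) (a hi) ->
  exists s, lo <= s <= hi /\ a s = p.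
Proof.
intros [Hpos [Hsep [Hsym Htri]]] H4 Hlh Hcont Hbtw.
apply NNPP; intros Hno.
assert (Hav : forall s, lo <= s <= hi -> 0 < d (a s) p).
{ intros s Hs. destruct (Rle_lt_or_eq_dec _ _ (Hpos (a s) p)) as [H|H]; [exact H|].
  exfalso; apply Hno; exists s; split; [exact Hs|]. apply Hsep; auto. }
(* "Same component of the complement of p": positivity of the Gromov product at p. *)
set (C := fun u v => d u v < d u p + d v p).
assert (Csym : forall u v, C u v -> C v u).
{ intros u v; unfold C; rewrite (Hsym v u); lra. }
assert (Ctrans : forall u v w, C u v -> C v w -> C u w).
{ intros u v w; unfold C; intros H1 H2.
  pose proof (H4 u v w p) as H.
  revert H; apply Rmax_case; lra. }
assert (Cnear : forall s s', lo <= s' <= hi -> d (a s) (a s') < d (a s) p -> C (a s) (a s')).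
{ intros s s' Hs H; unfold C. pose proof (Hav s' Hs); lra. }
set (E := fun s => lo <= s <= hi /\ forall s', lo <= s' <= s -> C (a lo) (a s')).
assert (Elo : E lo).
{ split; [lra|]. intros s' Hs'. replace s' with lo by lra.
  apply Cnear; [lra|]. replace (d (a lo) (a lo)) with 0; [apply Hav; lra|].
  symmetry; apply Hsep; reflexivity. }
destruct (completeness E) as [sg [Hub Hlub]].
{ exists hi; intros s [Hs _]; lra. }
{ exists lo; exact Elo. }
assert (Hsg : lo <= sg <= hi).
{ split; [apply Hub; exact Elo|]. apply Hlub; intros s [Hs _]; lra. }
destruct (Hcont sg Hsg (d (a sg) p) (Hav sg Hsg)) as [del [Hdel Hnear]].
assert (Hs : exists s, E s /\ sg - del < s).
{ apply NNPP; intros Hn.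
  assert (sg <= sg - del); [|lra].
  apply Hlub; intros s Hs. destruct (Rle_or_lt s (sg - del)) as [H|H]; [exact H|].
  exfalso; apply Hn; exists s; auto. }
destruct Hs as [s [[Hs1 Hs2] Hs3]].
assert (Hssg : s <= sg) by (apply Hub; split; auto).
assert (Hbig : forall s', lo <= s' <= hi -> s' < sg + del -> C (a lo) (a s')).
{ intros s' H1 H2. destruct (Rle_or_lt s' s) as [H|H].
  - apply Hs2; lra.
  - apply Ctrans with (a s); [apply Hs2; lra|].
    apply Ctrans with (a sg).
    + apply Csym, Cnear; [lra|]. apply Hnear; [lra|]. rewrite Rabs_right; lra.
    + apply Cnear; [lra|]. apply Hnear; [lra|]. apply Rabs_def1; lra. }
assert (Hend : sg = hi).
{ apply Rle_antisym; [lra|]. apply Rnot_lt_le; intros Hlt.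
  assert (Rmin hi (sg + del / 2) <= sg).
  { apply Hub. unfold E; apply Rmin_case_strong; intros Hm; (split; [lra|]);
    intros s' Hs'; apply Hbig; lra. }
  revert H; apply Rmin_case; lra. }
assert (H : C (a lo) (a hi)) by (apply Hbig; lra).
unfold C in H. rewrite (Hsym p (a hi)) in Hbtw. lra.
Qed.

(** Points of the geodesic lie between its ends, so the arc meets them. Conversely, an excursion off
    the geodesic would have to start and end at one point, against injectivity. *)
Lemma metric_tree_of_four_point {T : Type} (d : T -> T -> R) :
  is_metric d -> four_point d ->
  (forall x y, exists g, geodesic_segment d x y g) -> metric_tree d.
Proof.
intros Hd H4 Hgeo. split; [exact Hd|].
intros x y. destruct (Hgeo x y) as [g Hg]. exists g; split; [exact Hg|].
destruct Hg as [g0 [gL gd]].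
pose proof Hd as [Hpos [Hsep [Hsym Htri]]].
intros a [a0 [a1 [acont ainj]]] p.
assert (HL := Hpos x y).
assert (gx : forall s, 0 <= s <= d x y -> d x (g s) = s /\ d (g s) y = d x y - s).
{ intros s Hs; split.
  - rewrite -{1}g0 gd; [|lra|lra]. rewrite Rabs_left1; lra.
  - rewrite -{1}gL gd; [|lra|lra]. rewrite Rabs_left1; lra. }
assert (sub : forall lo hi q, 0 <= lo <= hi -> hi <= 1 ->
   d (a lo) q + d q (a hi) = d (a lo) (a hi) -> exists s, lo <= s <= hi /\ a s = q).
{ intros lo hi q H1 H2 H3.
  apply (path_hits_between d a lo hi q Hd H4); [lra| |exact H3].
  intros s Hs eps Heps. destruct (acont s ltac:(lra) eps Heps) as [del [Hdel Hc]].
  exists del; split; [exact Hdel|]. intros s' Hs'; apply Hc; lra. }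
split.
- intros [s0 [Hs0 Hp]].
  apply NNPP; intros Hno.
  set (u := (d x y + d x p - d p y) / 2).
  (* The projection of p to the geodesic: the arc has to visit it both before and after p. *)
  assert (Hu : 0 <= u <= d x y).
  { pose proof (Htri p x y); pose proof (Htri x y p).
    rewrite (Hsym p x) in H; rewrite (Hsym y p) in H0. unfold u; lra. }
  destruct (gx u Hu) as [H1 H2].
  assert (Hmp : d (g u) p <= (d x p + d p y - d x y) / 2).
  { pose proof (H4 x p y (g u)) as H.
    rewrite (Hsym y (g u)) H1 H2 (Hsym p (g u)) in H.
    revert H; unfold u; apply Rmax_case; lra. }
  pose proof (Htri x (g u) p) as T1. pose proof (Htri p (g u) y) as T2.
  rewrite (Hsym p (g u)) in T2.
  destruct (sub 0 s0 (g u)) as [s1 [Hs1 E1]]; [lra|lra| |].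
  { rewrite a0 Hp. unfold u in *; lra. }
  destruct (sub s0 1 (g u)) as [s2 [Hs2 E2]]; [lra|lra| |].
  { rewrite a1 Hp (Hsym p (g u)). unfold u in *; lra. }
  assert (s1 = s2) by (apply ainj; [lra|lra|congruence]).
  apply Hno; exists u; split; [exact Hu|].
  rewrite -E1 -Hp. f_equal; lra.
- intros [s [Hs Hp]].
  destruct (gx s Hs) as [H1 H2].
  apply (sub 0 1 p); [lra|lra|]. rewrite a0 a1 -Hp. lra.
Qed.

(** [G x y] is to be read as the height at which the segments from a root to [x] and to [y] part.
    Then [G x x] is the height of [x], and [ultra_dist] the path length through the branch point. *)
Definition ultra_product {X : Type} (G : X -> X -> R) : Prop :=
  (forall x y, 0 <= G x y) /\ (forall x y, G x y = G y x) /\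
  (forall x y, G x y <= G x x) /\ (forall x y z, Rmin (G x y) (G y z) <= G x z).

Definition ultra_dist {X : Type} (G : X -> X -> R) (x y : X) : R :=
  G x x + G y y - 2 * G x y.

(** Ultrametric triangles are isosceles: the least of the three values occurs twice. *)
Lemma ultra_triple {X : Type} (G : X -> X -> R) x y z : ultra_product G ->
  (G x y = G x z /\ G x y <= G y z) \/ (G x y = G y z /\ G x y <= G x z) \/
  (G x z = G y z /\ G x z <= G x y).
Proof.
intros [_ [Hs [_ Hu]]].
pose proof (Hu x y z) as H1. pose proof (Hu y x z) as H2. pose proof (Hu x z y) as H3.
rewrite (Hs y x) in H2. rewrite (Hs z y) in H3.
revert H1 H2 H3; unfold Rmin; repeat (destruct (Rle_dec _ _)); intros; lra.
Qed.

Lemma ultra_four_point {X : Type} (G : X -> X -> R) :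
  ultra_product G -> four_point (ultra_dist G).
Proof.
intros HG u v w p. unfold ultra_dist.
pose proof (ultra_triple G u v w HG). pose proof (ultra_triple G u v p HG).
pose proof (ultra_triple G u w p HG). pose proof (ultra_triple G v w p HG).
unfold Rmax; destruct (Rle_dec _ _); lra.
Qed.

Section Tree.
Context {X : Type} (G : X -> X -> R) (HG : ultra_product G).

(* A point of the tree is a pair (x, s) with 0 <= s <= G x x, where (x, s) and (y, s) are
   identified when s <= G x y; [canon s] picks a representative of the class. *)
Let canon (s : R) (x : X) : X := epsilon (inhabits x) (fun y => s <= G x y).

Let canonP s x : s <= G x x -> s <= G x (canon s x).
Proof. intros H. unfold canon. apply epsilon_spec. exists x; exact H. Qed.

Let canon_eq s x y : s <= G x y -> canon s x = canon s y.
Proof.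
destruct HG as [_ [Hs [Hm Hu]]]. intros H. unfold canon.
assert (E : (fun z => s <= G x z) = (fun z => s <= G y z)).
{ apply functional_extensionality; intros z; apply propositional_extensionality; split; intros H1.
  - pose proof (Hu y x z) as H2. rewrite (Hs y x) in H2. revert H2; apply Rmin_case; lra.
  - pose proof (Hu x y z) as H2. revert H2; apply Rmin_case; lra. }
rewrite E. apply epsilon_inh_irrelevance. exists y.
specialize (Hm y x). rewrite (Hs y x) in Hm. lra.
Qed.

Let tree := {p : X * R | 0 <= snd p <= G (fst p) (fst p) /\ canon (snd p) (fst p) = fst p}.
Let pt (p : tree) := fst (proj1_sig p).
Let ht (p : tree) := snd (proj1_sig p).
(** The paths from the root to [p] and [q] part where their branches do, or at the lower of the two
    points. *)
Let gprod (p q : tree) := Rmin (Rmin (ht p) (ht q)) (G (pt p) (pt q)).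

Let clamp x s := Rmax 0 (Rmin s (G x x)).

Let clampP x s : 0 <= clamp x s <= G x x.
Proof.
destruct HG as [H0 _]. specialize (H0 x x). unfold clamp, Rmax, Rmin.
repeat destruct (Rle_dec _ _); lra.
Qed.

Let mkP x s : let c := canon (clamp x s) x in
  0 <= snd (c, clamp x s) <= G (fst (c, clamp x s)) (fst (c, clamp x s)) /\
  canon (snd (c, clamp x s)) (fst (c, clamp x s)) = fst (c, clamp x s).
Proof.
intros c; simpl. pose proof (clampP x s). pose proof (canonP (clamp x s) x ltac:(lra)) as H1.
destruct HG as [_ [Hs [Hm Hu]]].
fold c in H1. specialize (Hm c x). rewrite (Hs c x) in Hm.
split; [lra|]. unfold c at 2. apply canon_eq. rewrite Hs; exact H1.
Qed.

Let mk (x : X) (s : R) : tree := exist _ (canon (clamp x s) x, clamp x s) (mkP x s).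

Let clamp_id x s : 0 <= s <= G x x -> clamp x s = s.
Proof. intros; unfold clamp, Rmax, Rmin; repeat destruct (Rle_dec _ _); lra. Qed.

Let ht_mk x s : 0 <= s <= G x x -> ht (mk x s) = s.
Proof. exact (clamp_id x s). Qed.

Let pt_mk x s : 0 <= s <= G x x -> pt (mk x s) = canon s x.
Proof. intros H. unfold pt; simpl. rewrite clamp_id //. Qed.

Let gprod_ultra : ultra_product gprod.
Proof.
destruct HG as [H0 [Hs [Hm Hu]]].
assert (Hht : forall p : tree, 0 <= ht p <= G (pt p) (pt p)) by (intros p; apply (proj2_sig p)).
split; [|split; [|split]].
- intros p q. unfold gprod. pose proof (Hht p); pose proof (Hht q); pose proof (H0 (pt p) (pt q)).
  repeat apply Rmin_case; lra.
- intros p q. unfold gprod. rewrite (Rmin_comm (ht p)) Hs. reflexivity.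
- intros p q. unfold gprod. pose proof (Hht p). unfold Rmin; repeat destruct (Rle_dec _ _); lra.
- intros p q r. unfold gprod. pose proof (Hu (pt p) (pt q) (pt r)) as H.
  revert H; unfold Rmin; repeat destruct (Rle_dec _ _); lra.
Qed.

Let htP (p : tree) : 0 <= ht p <= G (pt p) (pt p).
Proof. apply (proj2_sig p). Qed.

Let gprod_diag (p : tree) : gprod p p = ht p.
Proof. unfold gprod. pose proof (htP p). unfold Rmin; repeat destruct (Rle_dec _ _); lra. Qed.

Let tree_eq (p q : tree) : ht p = ht q -> ht p <= G (pt p) (pt q) -> p = q.
Proof.
destruct p as [[x s] [Hp1 Hp2]], q as [[y s'] [Hq1 Hq2]]; unfold ht, pt; simpl in *.
intros E H; subst s'. pose proof (canon_eq s x y H) as E. rewrite Hp2 Hq2 in E. subst y.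
f_equal; apply proof_irrelevance.
Qed.

(** Passing to canonical representatives changes [G] only above the heights [s] and [s'], where the
    minimum hides the change. *)
Let gprod_mk x s y s' : 0 <= s <= G x x -> 0 <= s' <= G y y ->
  gprod (mk x s) (mk y s') = Rmin (Rmin s s') (G x y).
Proof.
intros Hx Hy. unfold gprod. rewrite !ht_mk // !pt_mk //.
pose proof (canonP s x ltac:(lra)) as H1. pose proof (canonP s' y ltac:(lra)) as H2.
set (c := canon s x) in *. set (c' := canon s' y) in *.
pose proof (ultra_triple G x y c HG). pose proof (ultra_triple G y c c' HG).
unfold Rmin; repeat destruct (Rle_dec _ _); lra.
Qed.

Let mk_eq x y s : 0 <= s <= G x y -> mk x s = mk y s.
Proof.
intros H. destruct HG as [_ [Hs [Hm _]]].
pose proof (Hm x y) as H1. pose proof (Hm y x) as H2. rewrite (Hs y x) in H2.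
apply tree_eq; rewrite !ht_mk; try lra. rewrite !pt_mk; try lra.
rewrite -(canon_eq s x y); [|lra].
apply (Rle_trans _ (G x (canon s x))); [apply canonP; lra|].
specialize (Hm (canon s x) x). rewrite (Hs _ x) in Hm. exact Hm.
Qed.

Let mk_self (p : tree) : mk (pt p) (ht p) = p.
Proof.
pose proof (htP p) as H.
apply tree_eq; rewrite ht_mk //. rewrite pt_mk //.
destruct HG as [_ [Hs _]]. rewrite Hs. apply canonP, H.
Qed.

Let tree_metric : is_metric (ultra_dist gprod).
Proof.
pose proof gprod_ultra as [H0 [Hs [Hm Hu]]].
split; [|split; [|split]]; unfold ultra_dist.
- intros p q. pose proof (Hm p q). pose proof (Hm q p) as H1. rewrite (Hs q p) in H1. lra.
- intros p q; split; [|intros ->; lra].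
  rewrite !gprod_diag. intros H. unfold gprod in H.
  apply tree_eq; revert H; unfold Rmin; repeat destruct (Rle_dec _ _); lra.
- intros p q. rewrite (Hs q p). lra.
- intros p q r. pose proof (Hu p q r) as H. pose proof (Hm q p) as H1. pose proof (Hm q r).
  rewrite (Hs q p) in H1. revert H; apply Rmin_case_strong; lra.
Qed.

Let tree_geodesic p q : exists g, geodesic_segment (ultra_dist gprod) p q g.
Proof.
set (c := gprod p q). set (s := ht p). set (s' := ht q).
(* Descend from [p] to the branch point at height [c], then climb towards [q]; past [s - c] the
   height is [c + (u - (s - c))]. *)
exists (fun u => if Rle_dec u (s - c) then mk (pt p) (s - u) else mk (pt q) (u + 2 * c - s)).
pose proof (htP p) as Hp. pose proof (htP q) as Hq.
assert (Hc : 0 <= c) by apply gprod_ultra.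
assert (Hcs : c <= s /\ c <= s' /\ c <= G (pt p) (pt q) /\ (c = s \/ c = s' \/ c = G (pt p) (pt q))).
{ unfold c, gprod. fold s s'. unfold Rmin; repeat destruct (Rle_dec _ _); lra. }
assert (HL : ultra_dist gprod p q = s + s' - 2 * c).
{ unfold ultra_dist. rewrite !gprod_diag. reflexivity. }
fold s in Hp; fold s' in Hq.
split; [|split].
- destruct (Rle_dec 0 (s - c)); [|lra]. rewrite Rminus_0_r. apply mk_self.
- rewrite HL. destruct (Rle_dec _ _) as [H|H].
  (* Here [q] is itself the branch point, so the path ends on the branch of [p]. *)
  + assert (E : c = s') by lra.
    rewrite -{2}(mk_self q). fold s'. replace (s - (s + s' - 2 * c)) with s' by lra.
    apply mk_eq; lra.
  + replace (s + s' - 2 * c + 2 * c - s) with s' by lra. apply mk_self.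
- rewrite HL. intros u v Hu Hv.
  assert (Hdiag : forall x a b, 0 <= a <= G x x -> 0 <= b <= G x x ->
     ultra_dist gprod (mk x a) (mk x b) = Rabs (a - b)).
  { intros x a b Ha Hb. unfold ultra_dist. rewrite !gprod_mk //.
    unfold Rabs; destruct (Rcase_abs _); unfold Rmin; repeat destruct (Rle_dec _ _); lra. }
  assert (Hcross : forall u v, 0 <= u <= s - c -> s - c <= v <= s + s' - 2 * c ->
     ultra_dist gprod (mk (pt p) (s - u)) (mk (pt q) (v + 2 * c - s)) = v - u).
  { intros a b Ha Hb. unfold ultra_dist. rewrite !gprod_mk; try lra.
    unfold Rmin; repeat destruct (Rle_dec _ _); lra. }
  destruct (Rle_dec u (s - c)); destruct (Rle_dec v (s - c)).
  + rewrite Hdiag; try lra. rewrite Rabs_minus_sym. f_equal; lra.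
  + rewrite Hcross; try lra. rewrite Rabs_left1; lra.
  + replace (ultra_dist _ _ _) with
      (ultra_dist gprod (mk (pt p) (s - v)) (mk (pt q) (u + 2 * c - s))).
    * rewrite Hcross; try lra. rewrite Rabs_right; lra.
    * apply (proj1 (proj2 (proj2 tree_metric))).
  + rewrite Hdiag; try lra. f_equal; lra.
Qed.

Lemma tree_of_ultra_product :
  exists (T : Type) (dT : T -> T -> R) (f : X -> T),
    metric_tree dT /\ forall x y, dT (f x) (f y) = ultra_dist G x y.
Proof.
exists tree, (ultra_dist gprod), (fun x => mk x (G x x)). split.
- apply metric_tree_of_four_point.
  + exact tree_metric.
  + apply ultra_four_point, gprod_ultra.
  + exact tree_geodesic.
- intros x y. unfold ultra_dist. destruct HG as [H0 [Hs [Hm Hu]]].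
  pose proof (H0 x x) as Hx. pose proof (H0 y y) as Hy. rewrite !gprod_mk; try lra.
  pose proof (Hm x y) as H1. pose proof (Hm y x) as H2. rewrite (Hs y x) in H2.
  unfold Rmin; repeat destruct (Rle_dec _ _); lra.
Qed.
End Tree.

(** * The tree of one color *)

Lemma Lub_Rbar_is_lub (E : R -> Prop) :
  (exists x, E x) -> bound E -> is_lub E (real (Lub_Rbar E)).
Proof.
intros [x Hx] [M HM]. destruct (Lub_Rbar_correct E) as [Hub Hlub].
pose proof (Hub x Hx) as H1. pose proof (Hlub (Finite M) HM) as H2.
destruct (Lub_Rbar E) as [l| |]; simpl in *; try contradiction.
split; [exact Hub|]. intros b Hb. exact (Hlub (Finite b) Hb).
Qed.

Section Coarse.
(* One color: [same l] is lying in a common member of that colour at scale [tau l], and the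
   bump functions [w l] are supported well inside these members. *)
Context {Z : Type} (d : Z -> Z -> R) (tau : nat -> R) (delta : R)
  (same : nat -> Z -> Z -> Prop) (w : nat -> Z -> R).
Hypotheses (Hd : is_metric d) (delta_gt0 : 0 < delta) (tau_gt0 : forall l, 0 < tau l)
  (tau_eighth : forall l, tau (S l) <= tau l / 8)
  (tau_delta : forall l, tau (S l) <= delta / 32 * tau l)
  (same_near : forall l z z', 0 < w l z -> 0 < w l z' -> d z z' < delta / 4 * tau l -> same l z z')
  (same_trans : forall l x y z, same l x y -> same l y z -> same l x z)
  (same_small : forall l z z', same l z z' -> d z z' <= tau l)
  (w_bounds : forall l z, 0 <= w l z <= 1)
  (w_lip : forall l z z', w l z <= w l z' + d z z' / (delta / 4 * tau l)).

Let d0 x : d x x = 0.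
Proof. apply (proj1 (proj2 Hd)). reflexivity. Qed.
Let dpos x y : 0 <= d x y. Proof. apply (proj1 Hd). Qed.
Let dsym x y : d x y = d y x. Proof. apply (proj1 (proj2 (proj2 Hd))). Qed.
Let dtri x y z : d x z <= d x y + d y z. Proof. apply (proj2 (proj2 (proj2 Hd))). Qed.

Lemma tau_antitone l m : (l <= m)%coq_nat -> tau m <= tau l.
Proof.
intros H; induction H as [|m H IH]; [lra|].
pose proof (tau_eighth m); pose proof (tau_gt0 m); lra.
Qed.

(** A step has to be short against an active level of each endpoint. The levels range over the [q]
    consecutive ones from [j] on. *)
Definition cstep (j q : nat) (z z' : Z) : Prop :=
  exists l l', ((j <= l)%coq_nat /\ (l < Nat.add j q)%coq_nat) /\
    ((j <= l')%coq_nat /\ (l' < Nat.add j q)%coq_nat) /\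
    0 < w l z /\ 0 < w l' z' /\ d z z' <= tau (S l) /\ d z z' <= tau (S l').

Definition conn (j q : nat) : Z -> Z -> Prop := clos_refl_trans_n1 Z (cstep j q).

(** Induction on the number of levels, for all starting levels at once. The bound is independent of
    [q], so arbitrarily deep chains stay near their start. *)
Lemma conn_extent q : forall j z0 z, conn j q z0 z -> d z0 z <= 2 * tau j.
Proof.
induction q as [|q IH]; intros j z0 z H.
{ destruct H as [|y z [l [l' [Hl _]]] _]; [|lia].
  rewrite d0. pose proof (tau_gt0 j); lra. }
pose proof (tau_gt0 j) as Htj. pose proof (tau_gt0 (S j)) as Htj1.
pose proof (tau_eighth j) as T1. pose proof (tau_delta j) as T2.
(* A chain visiting level j does so only inside one piece of level j: its excursions through
   the levels > j are too short to reach another one. *)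
assert (Inv : conn (S j) q z0 z \/ exists u v y y', conn (S j) q z0 y /\ d y u <= tau (S j) /\
  same j u v /\ 0 < w j v /\ d v y' <= tau (S j) /\ conn (S j) q y' z).
{ induction H as [|z z' Hst _ IHz]; [left; constructor|].
  assert (Hself : forall v, 0 < w j v -> same j v v).
  { intros v Hv. apply same_near; auto. rewrite d0. nra. }
  destruct Hst as [l [l' [Hl [Hl' [Hw [Hw' [H1 H2]]]]]]].
  assert (Hz : d z z' <= tau (S j)).
  { pose proof (tau_antitone (S j) (S l) ltac:(lia)); lra. }
  (* If the step touches level [j], the new point active there is within [4 * tau (S j)] of the
     previous one [v], if any: two short steps and an excursion of extent [2 * tau (S j)]. By
     [tau_delta] this is at most [delta / 8 * tau j], within reach of [same_near]. *)
  destruct (Nat.eq_dec l j) as [El|Nl]; [subst l|destruct (Nat.eq_dec l' j) as [El'|Nl']; [subst l'|]].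
  - destruct IHz as [Hc|[u [v [y [y' [Hy [Hyu [Huv [Hv [Hvy Hc]]]]]]]]]].
    + right; exists z, z, z, z'. rewrite d0. repeat split; auto; try lra. constructor.
    + right; exists u, z, y, z'. repeat split; auto; try constructor.
      apply same_trans with v; [exact Huv|]. apply same_near; auto.
      pose proof (IH _ _ _ Hc). pose proof (dtri v y' z). nra.
  - destruct IHz as [Hc|[u [v [y [y' [Hy [Hyu [Huv [Hv [Hvy Hc]]]]]]]]]].
    + right; exists z', z', z, z'. rewrite d0. repeat split; auto; try lra. constructor.
    + right; exists u, z', y, z'. rewrite d0. repeat split; auto; try lra; try constructor.
      apply same_trans with v; [exact Huv|]. apply same_near; auto.
      pose proof (IH _ _ _ Hc). pose proof (dtri v y' z). pose proof (dtri v z z'). nra.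
  - assert (Hst : cstep (S j) q z z').
    { exists l, l'; repeat split; auto; lia. }
    destruct IHz as [Hc|[u [v [y [y' [Hy [Hyu [Huv [Hv [Hvy Hc]]]]]]]]]].
    + left. econstructor; [exact Hst|exact Hc].
    + right; exists u, v, y, y'; repeat split; auto. econstructor; [exact Hst|exact Hc]. }
destruct Inv as [Hc|[u [v [y [y' [Hy [Hyu [Huv [Hv [Hvy Hc]]]]]]]]]].
- pose proof (IH _ _ _ Hc); lra.
(* The parts of the chain add up to [tau j + 6 * tau (S j)], at most [2 * tau j] by [tau_eighth]. *)
- pose proof (IH _ _ _ Hc). pose proof (IH _ _ _ Hy). pose proof (same_small _ _ _ Huv).
  pose proof (dtri z0 y z). pose proof (dtri y u z). pose proof (dtri u v z).
  pose proof (dtri v y' z). lra.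
Qed.

Lemma conn_more_levels j q q' z z' : (q <= q')%coq_nat -> conn j q z z' -> conn j q' z z'.
Proof.
intros Hq H; induction H as [|y z' [l [l' [H1 [H2 H3]]]] _ IH]; [constructor|].
econstructor; [|exact IH]. exists l, l'; repeat split; try apply H3; lia.
Qed.

Fixpoint height (z : Z) (m : nat) : R :=
  match m with O => 0 | S l => height z l + w l z end.

Lemma height_le z m k : (m <= k)%coq_nat -> height z m <= height z k <= height z m + (INR k - INR m).
Proof.
intros H; induction H as [|k H IH]; [lra|].
rewrite S_INR; simpl. pose proof (w_bounds k z); lra.
Qed.

Lemma height_ge0 z m : 0 <= height z m.
Proof. apply (height_le z 0 m). lia. Qed.

(** The Lipschitz constants of the bumps grow geometrically with the level, so their sum over
    [l < m] is bounded by the next one, [4 / (delta * tau m)]. *)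
Lemma height_lip z z' m : height z m <= height z' m + 4 / delta * (d z z' / tau m).
Proof.
assert (Hnn : forall l, 0 <= d z z' / tau l).
{ intros l. apply Rdiv_le_0_compat; auto. }
assert (H4 : 0 < 4 / delta) by (apply Rdiv_lt_0_compat; lra).
induction m as [|m IH]; simpl.
- pose proof (Hnn O). nra.
- pose proof (w_lip m z z') as H. pose proof (Hnn m) as Hm.
  replace (d z z' / (delta / 4 * tau m)) with (4 / delta * (d z z' / tau m)) in H.
  2:{ field. pose proof (tau_gt0 m); lra. }
  assert (2 * (d z z' / tau m) <= d z z' / tau (S m)).
  { replace (2 * (d z z' / tau m)) with (d z z' * (2 / tau m)) by (field; apply Rgt_not_eq, tau_gt0).
    apply Rmult_le_compat_l; [auto|].
    pose proof (tau_gt0 m); pose proof (tau_gt0 (S m)); pose proof (tau_eighth m).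
    apply (Rmult_le_reg_r (tau m * tau (S m))); [nra|]. field_simplify; lra. }
  nra.
Qed.

Lemma height_lip_scale z z' m c : d z z' <= c * tau m -> height z m <= height z' m + c * (4 / delta).
Proof.
intros H. pose proof (height_lip z z' m) as H1. pose proof (tau_gt0 m).
assert (d z z' / tau m <= c) by (apply Rle_div_l; lra).
assert (0 < 4 / delta) by (apply Rdiv_lt_0_compat; lra). nra.
Qed.

(** The alternative [s <= 0] links everything, which places all points over one root. *)
Definition link (s : R) (x y : Z * nat) : Prop :=
  s <= 0 \/ exists m, (m <= snd x)%coq_nat /\ (m <= snd y)%coq_nat /\ d (fst x) (fst y) <= tau m /\
    s <= height (fst x) m /\ s <= height (fst y) m.

(* The ultrametric hull of the relation [link s] at all thresholds s. *)
Definition linked (x y : Z * nat) (s : R) : Prop :=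
  s <= height (fst x) (snd x) /\ clos_refl_trans_n1 _ (link s) x y.

Definition overlap (x y : Z * nat) : R := real (Lub_Rbar (linked x y)).

(** The thresholds include 0 and are bounded by the height of [x], so [real] is applied to a finite
    supremum. *)
Lemma linked_lub x y : is_lub (linked x y) (overlap x y).
Proof.
apply Lub_Rbar_is_lub.
- exists 0; split; [apply height_ge0|]. econstructor; [|constructor]. left; lra.
- exists (height (fst x) (snd x)). intros s [H _]; exact H.
Qed.

Lemma linked_low x y s : s <= 0 -> linked x y s.
Proof.
intros Hs; split; [pose proof (height_ge0 (fst x) (snd x)); lra|].
econstructor; [|constructor]. left; exact Hs.
Qed.

Lemma linked_trans x y z s : linked x y s -> linked y z s -> linked x z s.
Proof.
intros [H1 H2] [_ H3]; split; [exact H1|].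
apply clos_rt_rtn1, rt_trans with y; apply clos_rtn1_rt; assumption.
Qed.

Lemma linked_mono x y s s' : s' <= s -> linked x y s -> linked x y s'.
Proof.
intros Hs [H1 H2]; split; [lra|].
induction H2 as [|y z Hl _ IH]; [constructor|]. econstructor; [|exact IH].
destruct Hl as [H|[m [? [? [? [? ?]]]]]]; [left; lra|right; exists m; repeat split; auto; lra].
Qed.

(** The bound by the height of [x] is traded for one by the height of [y] through the last link,
    whose level does not exceed that of [y]. *)
Lemma linked_sym x y s : linked x y s -> linked y x s.
Proof.
assert (Hsym : forall u v, link s u v -> link s v u).
{ intros u v [H|[m H]]; [left; exact H|right; exists m]. rewrite dsym. tauto. }
intros [H1 H2]. split.
- destruct H2 as [|y z Hl _]; [exact H1|]. destruct Hl as [H|[m [_ [H2 [_ [_ H3]]]]]].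
  + pose proof (height_ge0 (fst z) (snd z)); lra.
  + pose proof (height_le (fst z) m (snd z) H2); lra.
- clear H1. induction H2 as [|y z Hl _ IH]; [constructor|].
  apply clos_rt_rtn1, rt_trans with y; [apply rt_step, Hsym, Hl|apply clos_rtn1_rt, IH].
Qed.

Lemma overlap_diag x : overlap x x = height (fst x) (snd x).
Proof.
destruct (linked_lub x x) as [Hub Hlub]. apply Rle_antisym.
- apply Hlub; intros s [H _]; exact H.
- apply Hub. split; [lra|constructor].
Qed.

(** Chains concatenate at the smaller of their thresholds. *)
Lemma overlap_ultra : ultra_product overlap.
Proof.
assert (Hs : forall x y, overlap x y <= overlap y x).
{ intros x y. apply (linked_lub x y). intros s H. apply linked_lub, linked_sym, H. }
split; [|split; [|split]].
- intros x y. apply linked_lub, linked_low; lra.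
- intros x y. apply Rle_antisym; apply Hs.
- intros x y. rewrite overlap_diag. apply (linked_lub x y); intros s [H _]; exact H.
- intros x y z. apply Rnot_lt_le; intros Hlt.
  assert (Happ : forall u v, overlap x z < overlap u v -> exists s, overlap x z < s /\ linked u v s).
  { intros u v H. apply NNPP; intros Hn. destruct (linked_lub u v) as [_ Hl].
    assert (overlap u v <= overlap x z); [|lra]. apply Hl; intros s Hs'.
    apply Rnot_lt_le; intros H1; apply Hn; exists s; auto. }
  destruct (Happ x y) as [s [Hs1 Hs2]].
  { pose proof (Rmin_l (overlap x y) (overlap y z)); lra. }
  destruct (Happ y z) as [s' [Hs1' Hs2']].
  { pose proof (Rmin_r (overlap x y) (overlap y z)); lra. }
  assert (Rmin s s' <= overlap x z).
  { apply linked_lub. apply linked_trans with y.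
    - apply linked_mono with s; [apply Rmin_l|exact Hs2].
    - apply linked_mono with s'; [apply Rmin_r|exact Hs2']. }
  revert H; apply Rmin_case; lra.
Qed.

Lemma active_between z j m : height z j < height z m ->
  exists l, ((j <= l)%coq_nat /\ (l < m)%coq_nat) /\ 0 < w l z.
Proof.
induction m as [|m IH]; simpl; intros H; [pose proof (height_ge0 z j); lra|].
destruct (Nat.le_gt_cases j m) as [Hjm|Hjm].
- destruct (Rlt_or_le 0 (w m z)) as [Hw|Hw]; [exists m; split; [lia|exact Hw]|].
  destruct IH as [l [Hl Hl']]; [lra|]. exists l; split; [lia|exact Hl'].
- pose proof (height_le z (S m) j ltac:(lia)) as H1; simpl in H1. lra.
Qed.

(* Along a chain of links above the threshold every point is active at some level >= j, so
   [conn_extent] keeps the chain within distance [2 * tau j] of [z]. *)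
Lemma overlap_far z k z' k' j :
  2 * tau j < d z z' -> overlap (z, k) (z', k') <= height z j + 12 / delta.
Proof.
intros Hfar. apply (linked_lub (z, k) (z', k')). intros s [_ Hs].
apply Rnot_lt_le; intros Hlt.
assert (Hconn : exists q, conn j q z (fst (z', k'))).
{ assert (H12 : 0 < 4 / delta) by (apply Rdiv_lt_0_compat; lra).
  (* The slack serves both ends of a link: [u] is within [2 * tau j] of [z] and [v] within
     [3 * tau j], so their heights at level [j] are still below [s], and each is active at some
     level from [j] on. *)
  replace (12 / delta) with (3 * (4 / delta)) in Hlt by (field; lra).
  induction Hs as [|y y' Hl _ [q IH]]; [exists O; constructor|].
  pose proof (conn_extent _ _ _ _ IH) as Hzy. pose proof (tau_gt0 j) as Htj.
  destruct Hl as [H|[m [_ [_ [Hyy [H1 H2]]]]]]; [pose proof (height_ge0 z j); lra|].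
  set (u := fst y) in *; set (v := fst y') in *.
  pose proof (height_lip_scale u z j 2 ltac:(rewrite dsym; exact Hzy)) as Hu.
  destruct (active_between u j m) as [l [Hl Hwl]]; [lra|].
  pose proof (tau_antitone j m ltac:(lia)) as Htm.
  pose proof (height_lip_scale v z j 3 ltac:(pose proof (dtri z u v); rewrite dsym; lra)) as Hv.
  destruct (active_between v j m) as [l' [Hl' Hwl']]; [lra|].
  exists (Nat.max q m). econstructor.
  2: apply (conn_more_levels j q); [lia|exact IH].
  exists l, l'. pose proof (tau_antitone (S l) m ltac:(lia)). pose proof (tau_antitone (S l') m ltac:(lia)).
  repeat split; auto; try lia; lra. }
destruct Hconn as [q Hq]. pose proof (conn_extent _ _ _ _ Hq); simpl in *; lra.
Qed.

(** One link at level [m] makes the overlap at least the smaller height there. The two heights at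
    [m] differ by a constant, and each grows by at most one per level above [m]. At level 0 all
    heights vanish. *)
Lemma overlap_near z k z' k' m :
  (m <= k)%coq_nat -> (m <= k')%coq_nat -> m = O \/ d z z' <= tau m ->
  ultra_dist overlap (z, k) (z', k') <= INR k + INR k' - 2 * INR m + 8 / delta.
Proof.
intros Hk Hk' Hm. unfold ultra_dist; rewrite !overlap_diag; simpl.
replace (8 / delta) with (2 * (4 / delta)) by (field; lra).
pose proof (height_le z m k Hk). pose proof (height_le z' m k' Hk').
assert (H4 : 0 < 4 / delta) by (apply Rdiv_lt_0_compat; lra).
destruct Hm as [->|Hm].
- assert (0 <= overlap (z, k) (z', k')) by apply overlap_ultra. simpl in *. lra.
- pose proof (height_lip_scale z z' m 1 ltac:(lra)). pose proof (height_lip_scale z' z m 1 ltac:(rewrite dsym; lra)).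
  assert (Rmin (height z m) (height z' m) <= overlap (z, k) (z', k')).
  { apply linked_lub. split; simpl; [pose proof (Rmin_l (height z m) (height z' m)); lra|].
    econstructor; [|constructor]. right; exists m; repeat split; auto; [apply Rmin_l|apply Rmin_r]. }
  revert H3; apply Rmin_case_strong; lra.
Qed.

Lemma ultra_dist_overlap_ge z k z' k' :
  height z k - overlap (z, k) (z', k') <= ultra_dist overlap (z, k) (z', k').
Proof.
unfold ultra_dist; rewrite !overlap_diag; simpl.
destruct overlap_ultra as [_ [Hs [Hm _]]].
pose proof (Hm (z', k') (z, k)) as H. rewrite overlap_diag Hs in H; simpl in H. lra.
Qed.

(** Replaces [overlap_far] when the meeting level is [k'] itself: the overlap is at most the height
    of [(z', k')], which is close to that of [z] at the same level. *)
Lemma overlap_radial z k z' k' :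
  k' = O \/ d z z' <= tau k' -> overlap (z, k) (z', k') <= height z k' + 12 / delta.
Proof.
intros H.
destruct overlap_ultra as [_ [Hs [Hm _]]].
pose proof (Hm (z', k') (z, k)) as H2. rewrite overlap_diag Hs in H2; simpl in H2.
assert (H4 : 0 < 4 / delta) by (apply Rdiv_lt_0_compat; lra).
replace (12 / delta) with (3 * (4 / delta)) by (field; lra).
destruct H as [->|H]; [simpl in *; lra|].
pose proof (height_lip_scale z' z k' 1 ltac:(rewrite dsym; lra)) as H1. lra.
Qed.
End Coarse.

(** * Distances in the hyperbolic cone *)

(** The Taylor bound [x - x^3 / 6] with [x^2 <= 4]; the range covers half-angles up to [PI / 2]. *)
Lemma sin_ge_third x : 0 <= x <= 2 -> x / 3 <= sin x.
Proof.
intros Hx. pose proof PI2_3_2 as HPI.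
assert (HP : x <= PI) by lra.
destruct (sin_bound x 0 ltac:(lra) HP) as [H _]. apply Rle_trans with (2 := H).
unfold sin_approx, sin_term; simpl.
assert (x * x <= 4) by nra. nra.
Qed.

Lemma one_minus_cos_bounds th : 0 <= th <= PI -> th ^ 2 / 18 <= 1 - cos th <= th ^ 2 / 2.
Proof.
intros Hth. pose proof PI_4.
replace (cos th) with (1 - 2 * sin (th / 2) * sin (th / 2)).
2:{ rewrite -cos_2a_sin. f_equal; field. }
pose proof (sin_ge_third (th / 2) ltac:(lra)).
assert (sin (th / 2) <= th / 2).
{ destruct (Req_dec th 0) as [->|Hn]; [replace (0 / 2) with 0 by field; rewrite sin_0; lra|].
  left; apply sin_lt_x; lra. }
nra.
Qed.

Lemma acosh_bounds x : 1 <= x -> ln x <= acosh x <= ln (2 * x).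
Proof.
intros Hx. unfold acosh.
pose proof (sqrt_pos (x * x - 1)).
assert (sqrt (x * x - 1) <= x).
{ apply Rle_trans with (sqrt (x * x)); [apply sqrt_le_1; nra|rewrite sqrt_square; lra]. }
split; apply ln_le; lra.
Qed.

Lemma exp_le_compat x y : x <= y -> exp x <= exp y.
Proof. intros [H| ->]; [left; apply exp_increasing, H|lra]. Qed.

(** [q] acts as the Gromov product at the apex. The law of cosines reads [cosh (t - t') + sinh t
    sinh t' (1 - cos th)]; for radii at least 1 and [th] comparable to [e^(-q)], the second term is
    comparable to [e^(t + t' - 2q)]. If [q] is within [lam] of a radius, the first term alone gives
    the lower bound. *)
Lemma hyp_side_estimate (A B lam : R) : 0 < B -> 0 <= lam ->
  exists C, 0 <= C /\ forall t t' th q, 0 < t -> 0 < t' -> 0 <= th <= PI ->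
    0 <= q -> q <= t -> q <= t' -> th <= A * exp (- q) ->
    (B * exp (- q) <= th \/ t - lam <= q \/ t' - lam <= q) ->
    Rabs (hyp_side t t' th - (t + t' - 2 * q)) <= C.
Proof.
intros HB Hlam.
(* The first logarithm serves the upper bound, the second the lower one, where 288 is 18 from
   [1 - cos th >= th^2 / 18] times 16 from two factors [sinh u >= exp u / 4]. The term [ln 2] comes
   from [cosh >= exp / 2], and the final 2 absorbs radii below 1. *)
exists (Rabs (ln (2 + A ^ 2)) + Rabs (ln (B ^ 2 / 288)) + ln 2 + 2 * lam + 2).
pose proof (Rabs_pos (ln (2 + A ^ 2))). pose proof (Rabs_pos (ln (B ^ 2 / 288))).
assert (Hl2 : 0 < ln 2) by (rewrite -ln_1; apply ln_increasing; lra).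
split; [lra|]. intros t t' th q Ht Ht' Hth Hq Hqt Hqt' HA Hor.
destruct (one_minus_cos_bounds th Hth) as [Hc1 Hc2].
set (c := 1 - cos th) in *.
set (X := cosh t * cosh t' - sinh t * sinh t' * cos th).
assert (HX : X = cosh (t - t') + sinh t * sinh t' * c).
{ assert (Hsub : cosh (t - t') = cosh t * cosh t' - sinh t * sinh t').
  { unfold cosh, sinh. replace (- (t - t')) with (- t + t') by lra.
    unfold Rminus; rewrite !exp_plus. field. }
  rewrite Hsub /X /c. ring. }
assert (Hsinh : forall u, 0 <= u -> 0 <= sinh u <= exp u / 2).
{ intros u Hu. unfold sinh. pose proof (exp_pos (- u)).
  assert (exp (- u) <= exp u) by (apply exp_le_compat; lra). lra. }
assert (Hc0 : 0 <= c) by nra.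
destruct (Hsinh t ltac:(lra)) as [Hs0 Hs1]. destruct (Hsinh t' ltac:(lra)) as [Hs0' Hs1'].
assert (Hss : 0 <= sinh t * sinh t' * c) by (apply Rmult_le_pos; nra).
assert (Hcosh : exp (t - t') / 2 <= X /\ exp (t' - t) / 2 <= X).
{ rewrite HX. unfold cosh. replace (- (t - t')) with (t' - t) by lra.
  pose proof (exp_pos (t - t')). pose proof (exp_pos (t' - t)). lra. }
assert (HX1 : 1 <= X).
{ rewrite HX. unfold cosh.
  assert (Hab : exp (t - t') * exp (- (t - t')) = 1) by (rewrite -exp_plus Rplus_opp_r exp_0; reflexivity).
  pose proof (exp_pos (- (t - t'))) as Hb. revert Hab Hb.
  generalize (exp (t - t')) (exp (- (t - t'))); intros a b Hab Hb.
  (* As [a b = 1], this product equals [a + b - 2], so the hyperbolic cosine is at least 1. *)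
  assert (H1 : 0 <= (a - 1) * (a - 1) * b) by (apply Rmult_le_pos; [apply Rle_0_sqr|lra]).
  replace ((a - 1) * (a - 1) * b) with (a * (a * b) - 2 * (a * b) + b) in H1 by ring.
  rewrite Hab in H1. lra. }
destruct (acosh_bounds X HX1) as [HD1 HD2].
change (hyp_side t t' th) with (acosh X).
assert (HDX : forall a y, 0 < a -> a * exp y <= X -> ln a + y <= acosh X).
{ intros a y Ha Hy. apply Rle_trans with (2 := HD1).
  rewrite -{1}(ln_exp y) -ln_mult; [|lra|apply exp_pos].
  apply ln_le; [|lra]. apply Rmult_lt_0_compat; [exact Ha|apply exp_pos]. }
assert (Hln2 : ln (/ 2) = - ln 2) by (apply ln_Rinv; lra).
pose proof (HDX (/ 2) (t - t') ltac:(lra) ltac:(lra)) as HL1.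
pose proof (HDX (/ 2) (t' - t) ltac:(lra) ltac:(lra)) as HL2.
assert (Hqq : exp (- q) * exp (- q) = exp (- (2 * q))).
{ rewrite -exp_plus. f_equal; lra. }
assert (Htq : exp (t + t' - 2 * q) = exp t * exp t' * (exp (- q) * exp (- q))).
{ rewrite Hqq -!exp_plus. f_equal; lra. }
pose proof (exp_pos (- q)) as Hq0. pose proof (exp_pos t) as He. pose proof (exp_pos t') as He'.
set (Q := exp (- q)) in *. set (et := exp t) in *. set (et' := exp t') in *.
assert (Hup : acosh X <= ln (2 + A ^ 2) + (t + t' - 2 * q)).
{ apply Rle_trans with (1 := HD2).
  rewrite -{1}(ln_exp (t + t' - 2 * q)) -ln_mult; [|nra|apply exp_pos].
  apply ln_le; [lra|].
  assert (H1 : cosh (t - t') <= exp (t + t' - 2 * q)).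
  { unfold cosh. assert (exp (t - t') <= exp (t + t' - 2 * q)) by (apply exp_le_compat; lra).
    assert (exp (- (t - t')) <= exp (t + t' - 2 * q)) by (apply exp_le_compat; lra). lra. }
  assert (H2 : sinh t * sinh t' * c <= A ^ 2 / 8 * exp (t + t' - 2 * q)).
  { assert (c <= A ^ 2 * (Q * Q) / 2).
    { apply Rle_trans with (1 := Hc2). assert (th * th <= (A * Q) * (A * Q)) by (apply Rmult_le_compat; lra).
      simpl; lra. }
    assert (sinh t * sinh t' <= et / 2 * (et' / 2)) by (apply Rmult_le_compat; lra).
    rewrite Htq.
    apply Rle_trans with (et / 2 * (et' / 2) * (A ^ 2 * (Q * Q) / 2)).
    - apply Rmult_le_compat; nra.
    - right; field. }
  rewrite HX. pose proof (exp_pos (t + t' - 2 * q)). nra. }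
assert (Hlow : t + t' - 2 * q - (Rabs (ln (B ^ 2 / 288)) + ln 2 + 2 * lam + 2) <= acosh X).
{ destruct Hor as [Hor|[Hor|Hor]]; try lra.
  destruct (Rlt_or_le t 1) as [Ht1|Ht1]; [lra|]. destruct (Rlt_or_le t' 1) as [Ht1'|Ht1']; [lra|].
  assert (Hsl : forall u, 1 <= u -> exp u / 4 <= sinh u).
  { intros u Hu. unfold sinh. pose proof (exp_ineq1 u ltac:(lra)).
    assert (exp (- u) <= 1) by (rewrite -exp_0; apply exp_le_compat; lra). lra. }
  pose proof (Hsl t Ht1) as HS. pose proof (Hsl t' Ht1') as HS'. fold et in HS; fold et' in HS'.
  assert (B ^ 2 / 288 * exp (t + t' - 2 * q) <= X).
  { assert (B ^ 2 * (Q * Q) / 18 <= c).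
    { apply Rle_trans with (2 := Hc1).
      assert ((B * Q) * (B * Q) <= th * th) by (apply Rmult_le_compat; nra). simpl; lra. }
    assert (et / 4 * (et' / 4) <= sinh t * sinh t') by (apply Rmult_le_compat; lra).
    assert (et / 4 * (et' / 4) * (B ^ 2 * (Q * Q) / 18) <= sinh t * sinh t' * c).
    { apply Rmult_le_compat; try lra; [nra|]. apply Rmult_le_pos; [|lra].
      apply Rmult_le_pos; [apply pow2_ge_0|nra]. }
    rewrite HX Htq. assert (0 <= cosh (t - t')).
    { unfold cosh. pose proof (exp_pos (t - t')). pose proof (exp_pos (- (t - t'))). lra. }
    lra. }
  pose proof (HDX (B ^ 2 / 288) (t + t' - 2 * q) ltac:(nra) H1).
  pose proof (Rle_abs (- ln (B ^ 2 / 288))) as HR. rewrite Rabs_Ropp in HR. lra. }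
pose proof (Rle_abs (ln (2 + A ^ 2))).
apply Rabs_le. lra.
Qed.

(** * Bump functions of a colored covering *)

Lemma Rbar_lub_is_lub (E : Rbar -> Prop) : Rbar_is_lub E (Rbar_lub E).
Proof. exact (proj2_sig (Rbar_ex_lub E)). Qed.

Lemma Rbar_glb_is_glb (E : Rbar -> Prop) : Rbar_is_glb E (Rbar_glb E).
Proof. exact (proj2_sig (Rbar_ex_glb E)). Qed.

Lemma diam_set_ub {X : Type} (d : X -> X -> R) (S : X -> Prop) x y :
  S x -> S y -> Rbar_le (d x y) (diam_set d S).
Proof. intros Hx Hy. apply (proj1 (Rbar_lub_is_lub _)). exists x, y; auto. Qed.

Lemma dist_le_diam {X : Type} (d : X -> X -> R) x y : met_bounded d -> d x y <= diam d.
Proof.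
intros [M HM]. unfold diam.
pose proof (diam_set_ub d (fun _ => True) x y I I) as H1.
assert (H2 : Rbar_le (diam_set d (fun _ => True)) M).
{ apply (proj2 (Rbar_lub_is_lub _)). intros v [u [u' [_ [_ ->]]]]; apply HM. }
destruct (diam_set d _); simpl in *; [exact H1|contradiction|contradiction].
Qed.

Lemma dist_le_mesh {X : Type} (d : X -> X -> R) F U x y (m : R) :
  Rbar_le (mesh d F) m -> F U -> U x -> U y -> d x y <= m.
Proof.
intros Hm HU Hx Hy. change (Rbar_le (d x y) m).
apply Rbar_le_trans with (2 := Hm).
apply Rbar_le_trans with (1 := diam_set_ub d U x y Hx Hy).
apply (proj1 (Rbar_lub_is_lub _)). exists U; auto.
Qed.

Lemma lebesgue_ball {X : Type} (d : X -> X -> R) F (L : R) x :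
  0 < L -> Rbar_le L (lebesgue_number d F) ->
  exists U, F U /\ forall y, d x y < L / 2 -> U y.
Proof.
intros HL H.
set (Ex := fun s => exists U, F U /\ s = dist_compl d x U).
assert (H1 : Rbar_le L (Rbar_lub Ex)).
{ apply Rbar_le_trans with (1 := H).
  apply Rbar_le_trans with (2 := Rbar_min_l _ (mesh d F)).
  apply (proj1 (Rbar_glb_is_glb _)). exists x; reflexivity. }
apply NNPP; intros Hno.
assert (H2 : Rbar_le (Rbar_lub Ex) (L / 2)).
{ apply (proj2 (Rbar_lub_is_lub _)). intros s [U [HU ->]].
  destruct (not_all_ex_not _ _ (fun Hall => Hno (ex_intro _ U (conj HU Hall)))) as [y Hy].
  apply imply_to_and in Hy. destruct Hy as [Hy1 Hy2].
  apply Rbar_le_trans with (d x y); [|simpl; lra].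
  apply (proj1 (Rbar_glb_is_glb _)). exists y; auto. }
pose proof (Rbar_le_trans _ _ _ H1 H2) as H3; simpl in H3; lra.
Qed.

Lemma bump_exists {X : Type} (d : X -> X -> R) (V : X -> Prop) (eta : R) :
  is_metric d -> 0 < eta ->
  exists w : X -> R, (forall z, 0 <= w z <= 1) /\ (forall z, V z -> w z = 1) /\
    (forall z z', w z <= w z' + d z z' / eta) /\
    (forall z, 0 < w z -> exists v, V v /\ d z v < eta).
Proof.
intros [Hpos [Hsep [Hsym Htri]]] Heta.
(* The bump is the supremum of [1 - d z v / eta] over [v] in [V]; the value 0 cuts it off below and
   serves the case of empty [V]. *)
set (E := fun z y => y = 0 \/ exists v, V v /\ y = 1 - d z v / eta).
assert (Hnn : forall a b, 0 <= d a b / eta) by (intros; apply Rdiv_le_0_compat; auto).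
assert (HE1 : forall z y, E z y -> y <= 1).
{ intros z y [->|[v [_ ->]]]; [lra|]. pose proof (Hnn z v); lra. }
assert (Hlub : forall z, is_lub (E z) (real (Lub_Rbar (E z)))).
{ intros z. apply Lub_Rbar_is_lub; [exists 0; left; reflexivity|]. exists 1; intros y; apply HE1. }
exists (fun z => real (Lub_Rbar (E z))).
assert (Hb : forall z, 0 <= real (Lub_Rbar (E z)) <= 1).
{ intros z; split; [apply Hlub; left; reflexivity|]. apply Hlub; intros y; apply HE1. }
split; [exact Hb|]. split; [|split].
- intros z Hz. apply Rle_antisym; [apply Hb|]. apply Hlub. right; exists z; split; [exact Hz|].
  replace (d z z) with 0 by (symmetry; apply Hsep; reflexivity). field; lra.
- intros z z'. apply (Hlub z). intros y [->|[v [Hv ->]]].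
  + pose proof (Hb z'). pose proof (Hnn z z'). lra.
  + assert (1 - d z' v / eta <= real (Lub_Rbar (E z'))).
    { apply Hlub. right; exists v; auto. }
    assert (d z' v / eta <= d z v / eta + d z z' / eta).
    { unfold Rdiv; rewrite -Rmult_plus_distr_r. apply Rmult_le_compat_r.
      - left; apply Rinv_0_lt_compat, Heta.
      - pose proof (Htri z' z v) as H1. rewrite (Hsym z' z) in H1. lra. }
    lra.
- intros z Hz. apply NNPP; intros Hno.
  assert (real (Lub_Rbar (E z)) <= 0); [|lra].
  apply Hlub. intros y [->|[v [Hv ->]]]; [lra|].
  apply Rnot_lt_le; intros H1. apply Hno; exists v; split; [exact Hv|].
  assert (H2 : d z v / eta < 1) by lra. apply Rlt_div_l in H2; lra.
Qed.

(** What the trees need from the covering at one scale: the hypotheses on a single color, and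
    [layer_cover], which ties the colors together. *)
Record layer {Z : Type} (d : Z -> Z -> R) (n : nat) (delta tau : R)
  (same : 'I_n.+1 -> Z -> Z -> Prop) (w : 'I_n.+1 -> Z -> R) : Prop := Layer {
  layer_near : forall a z z', 0 < w a z -> 0 < w a z' -> d z z' < delta / 4 * tau -> same a z z';
  layer_trans : forall a x y z, same a x y -> same a y z -> same a x z;
  layer_small : forall a z z', same a z z' -> d z z' <= tau;
  layer_bounds : forall a z, 0 <= w a z <= 1;
  layer_lip : forall a z z', w a z <= w a z' + d z z' / (delta / 4 * tau);
  layer_cover : forall z, exists a, w a z = 1 }.

Arguments layer_near {Z d n delta tau same w}.
Arguments layer_trans {Z d n delta tau same w}.
Arguments layer_small {Z d n delta tau same w}.
Arguments layer_cover {Z d n delta tau same w}.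

Lemma layer_exists {Z : Type} (d : Z -> Z -> R) (n : nat) : is_metric d -> cdim_cond d n ->
  exists delta, 0 < delta /\ exists tau0, 0 < tau0 /\
    forall tau, 0 < tau <= tau0 -> exists p : ('I_n.+1 -> Z -> Z -> Prop) * ('I_n.+1 -> Z -> R),
      layer d n delta tau (fst p) (snd p).
Proof.
intros Hd [delta [Hdelta [tau0 [Htau0 Hcov]]]].
exists delta; split; [exact Hdelta|]. exists tau0; split; [exact Htau0|].
intros tau Htau. destruct (Hcov tau Htau) as [F [_ [[Fk [HF Hdisj]] [Hmesh HL]]]].
assert (Heta : 0 < delta / 4 * tau) by nra.
(* Around points of [V a] a member has room [delta * tau / 2]. The bumps use half of it; the other
   half lets nearby points of positive weight share that member. *)
set (V := fun (a : 'I_n.+1) z => exists U, Fk a U /\ forall y, d z y < delta * tau / 2 -> U y).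
pose (wex := fun a => constructive_indefinite_description _
   (bump_exists d (V a) (delta / 4 * tau) Hd Heta)).
set (w := fun a => proj1_sig (wex a)).
assert (Hw : forall a, (forall z, 0 <= w a z <= 1) /\ (forall z, V a z -> w a z = 1) /\
    (forall z z', w a z <= w a z' + d z z' / (delta / 4 * tau)) /\
    (forall z, 0 < w a z -> exists v, V a v /\ d z v < delta / 4 * tau)).
{ intros a. exact (proj2_sig (wex a)). }
exists ((fun (a : 'I_n.+1) z z' => exists U, Fk a U /\ U z /\ U z'), w).
destruct Hd as [Hpos [Hsep [Hsym Htri]]].
split; simpl.
- intros a z z' Hz Hz' Hzz.
  destruct (proj2 (proj2 (proj2 (Hw a))) z Hz) as [v [[U [HU HUv]] Hv]].
  rewrite Hsym in Hv.
  exists U; split; [exact HU|]. split; apply HUv; [lra|].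
  pose proof (Htri v z z'); lra.
- intros a x y z [U [HU [Hx Hy]]] [U' [HU' [Hy' Hz]]].
  exists U; repeat split; auto. apply (Hdisj a U U' HU HU'); [|exact Hz]. exists y; auto.
- intros a z z' [U [HU [Hz Hz']]]. apply (dist_le_mesh d F U z z' tau); auto.
  apply HF. exists a; split; [|exact HU]. rewrite -ltnS. apply ltn_ord.
- intros a; apply Hw.
- intros a; apply Hw.
- intros z. destruct (lebesgue_ball d F (delta * tau) z ltac:(nra) HL) as [U [HU HUz]].
  apply HF in HU. destruct HU as [k [Hk HU]].
  rewrite -ltnS in Hk. exists (Ordinal Hk). apply Hw. exists U; auto.
Qed.

(** * Finite sums and the product metric *)

Section FinSum.
Context {m : nat}.
Implicit Types F G : 'I_m -> R.

Lemma sumR_le F G : (forall a, F a <= G a) ->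
  \big[Rplus/0]_(a < m) F a <= \big[Rplus/0]_(a < m) G a.
Proof. move=> H; elim/big_ind2: _ => [|x1 x2 y1 y2|a _] *; [lra|lra|apply H]. Qed.

Lemma sumR_plus F G : \big[Rplus/0]_(a < m) (F a + G a) =
  \big[Rplus/0]_(a < m) F a + \big[Rplus/0]_(a < m) G a.
Proof.
elim: m F G => [|k IH] F G; [rewrite !big_ord0; lra|].
rewrite !big_ord_recl IH. lra.
Qed.

Lemma sumR_const c : \big[Rplus/0]_(a < m) c = INR m * c.
Proof.
elim: m => [|k IH]; [rewrite big_ord0; simpl; lra|].
rewrite big_ord_recl IH S_INR. lra.
Qed.
End FinSum.

Lemma sumR_ge0 m (F : 'I_m -> R) : (forall a, 0 <= F a) -> 0 <= \big[Rplus/0]_(a < m) F a.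
Proof. move=> H; elim/big_ind: _ => [|x y|a _] *; [lra|lra|apply H]. Qed.

Lemma sumR_single m (F : 'I_m -> R) a : (forall a, 0 <= F a) -> F a <= \big[Rplus/0]_(a < m) F a.
Proof.
elim: m F a => [|k IH] F a H; [destruct a; discriminate|].
rewrite big_ord_recl.
pose proof (sumR_ge0 k (fun i => F (lift ord0 i)) (fun i => H _)).
destruct (unliftP ord0 a) as [b Eb|Eb]; rewrite Eb; [|lra].
pose proof (IH (fun i => F (lift ord0 i)) b (fun i => H _)). pose proof (H ord0). simpl in *; lra.
Qed.

Lemma prod_dist_le_sup k (T : 'I_k -> Type) dT x y M : 0 <= M ->
  (forall a, 0 <= dT a (x a) (y a) <= M) -> prod_dist T dT x y <= INR k * M.
Proof.
intros HM H. unfold prod_dist.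
assert (Hk : 0 <= INR k) by apply pos_INR.
rewrite -(sqrt_pow2 (INR k * M)); [|nra]. apply sqrt_le_1_alt.
apply Rle_trans with (\big[Rplus/0]_(a < k) M ^ 2).
- apply sumR_le; intros a. apply pow_incr, H.
- rewrite sumR_const. destruct k as [|k]; [simpl; lra|].
  assert (1 <= INR k.+1) by (rewrite S_INR; pose proof (pos_INR k); lra).
  pose proof (pow2_ge_0 M). nra.
Qed.

Lemma sum_le_prod_dist k (T : 'I_k -> Type) dT x y :
  \big[Rplus/0]_(a < k) dT a (x a) (y a) <= INR k * prod_dist T dT x y.
Proof.
rewrite -sumR_const. apply sumR_le; intros a.
apply Rle_trans with (1 := Rle_abs _). rewrite -sqrt_Rsqr_abs. apply sqrt_le_1_alt.
rewrite Rsqr_pow2.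
apply (sumR_single k (fun a => dT a (x a) (y a) ^ 2)). intros; apply pow2_ge_0.
Qed.

(** Each level is seen with full weight by some color; this is how the radial coordinate is
    recovered. *)
Lemma sum_height_ge {Z : Type} m (w : nat -> 'I_m -> Z -> R) z j k :
  (forall l a, 0 <= w l a z) -> (forall l, exists a, w l a z = 1) -> (j <= k)%coq_nat ->
  INR k - INR j + \big[Rplus/0]_(a < m) height (fun l => w l a) z j <=
  \big[Rplus/0]_(a < m) height (fun l => w l a) z k.
Proof.
intros H0 H1 H; induction H as [|k H IH]; [lra|].
rewrite S_INR /= sumR_plus. destruct (H1 k) as [a Ha].
pose proof (sumR_single m (fun a => w k a z) a (H0 k)) as H2. simpl in *. lra.
Qed.

(** * The embedding *)

(** At [p] two points at distance [D] are still close while the next scale separates them, unless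
    the cap [m] comes first. Level 0 counts as close whatever [D] is. *)
Lemma meeting_level (tau : nat -> R) (D : R) m :
  exists p, (p <= m)%coq_nat /\ (p = O \/ D <= tau p) /\ (p = m \/ tau (S p) < D).
Proof.
induction m as [|m [p [H1 [H2 H3]]]]; [exists O; auto|].
destruct (Rle_or_lt D (tau (S m))) as [H|H].
- exists (S m); auto.
- exists p; split; [lia|]; split; [exact H2|]. right. destruct H3 as [->|H3]; auto.
Qed.

Lemma nat_floor (x : R) : 0 <= x -> exists k, INR k <= x < INR k + 1.
Proof.
intros Hx. destruct (INR_archimed 1 x ltac:(lra)) as [N HN]. rewrite Rmult_1_r in HN.
induction N as [|N IH]; [simpl in HN; lra|].
rewrite S_INR in HN. destruct (Rle_or_lt (INR N) x) as [H|H]; [exists N; lra|apply IH; lra].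
Qed.

(** Both metrics are compared with an intermediate quantity [N], the number of levels between the
    two points; [lam] is the radial length of a level. *)
Lemma qi_of_comparison {X : Type} (dX : X -> X -> R) n (T : 'I_n.+1 -> Type)
    (dT : forall a, T a -> T a -> R) (f : X -> forall a, T a) lam C1 C2 C3 :
  0 < lam -> 0 <= C1 -> 0 <= C2 -> 0 <= C3 ->
  (forall a u v, 0 <= dT a u v) ->
  (forall x y, exists N, 0 <= N /\ (forall a, dT a (f x a) (f y a) <= N + C1) /\
     N / 2 - C2 <= \big[Rplus/0]_(a < n.+1) dT a (f x a) (f y a) /\
     Rabs (dX x y - lam * N) <= C3) ->
  qi_embedding dX (prod_dist T dT) f.
Proof.
intros Hlam HC1 HC2 HC3 Hpos H.
set (k := INR n.+1). assert (Hk : 0 < k) by (apply lt_0_INR; lia).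
(* The term [k / lam] serves the upper estimate and [2 * lam * k] the lower one. *)
set (Lam := 1 + k / lam + 2 * lam * k).
assert (Hkl : 0 < k / lam) by (apply Rdiv_lt_0_compat; lra).
assert (Hlk : 0 < lam * k) by nra.
assert (HL1 : 1 <= Lam) by (unfold Lam; lra).
exists Lam, (Lam * C3 + k * C1 + 2 * lam * C2 + C3). split; [exact HL1|].
split; [nra|]. intros x y. destruct (H x y) as [N [HN [Hup [Hlow HD]]]].
apply Rabs_le_between in HD.
assert (HP0 : 0 <= prod_dist T dT (f x) (f y)) by apply sqrt_pos.
split.
- pose proof (sum_le_prod_dist n.+1 T dT (f x) (f y)) as HS. fold k in HS.
  set (P := prod_dist T dT (f x) (f y)) in *.
  assert (HX : dX x y <= Lam * P + (2 * lam * C2 + C3)).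
  { assert (lam * N <= lam * (2 * (k * P + C2))) by (apply Rmult_le_compat_l; lra).
    assert (2 * lam * k * P <= Lam * P) by (apply Rmult_le_compat_r; unfold Lam; lra). nra. }
  assert (0 <= 2 * lam * C2 + C3) by nra.
  apply Rle_trans with (P + (2 * lam * C2 + C3) - (Lam * C3 + k * C1 + 2 * lam * C2 + C3)); [|nra].
  apply Rplus_le_compat_r. apply Rle_div_l; [lra|]. nra.
- apply Rle_trans with (k * (N + C1)).
  + apply prod_dist_le_sup; [lra|]. intros a; split; [apply Hpos|apply Hup].
  + assert (k * N <= Lam * (dX x y + C3)).
    { apply Rle_trans with (k / lam * (dX x y + C3)).
      - replace (k * N) with (k / lam * (lam * N)) by (field; lra).
        apply Rmult_le_compat_l; lra.
      - apply Rmult_le_compat_r; [nra|unfold Lam; lra]. }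
    nra.
Qed.

Section Embedding.
Context {Z : Type} (d : Z -> Z -> R) (n : nat) (delta : R) (tau : nat -> R)
  (same : nat -> 'I_n.+1 -> Z -> Z -> Prop) (w : nat -> 'I_n.+1 -> Z -> R).
Hypotheses (Hd : is_metric d) (delta_gt0 : 0 < delta) (tau_gt0 : forall l, 0 < tau l)
  (tau_eighth : forall l, tau (S l) <= tau l / 8)
  (tau_delta : forall l, tau (S l) <= delta / 32 * tau l)
  (Hlayer : forall l, layer d n delta (tau l) (same l) (w l)).

(** [N] is the length of the path through the meeting level [p]. The sum over the colors dominates
    both [k - p] and [k' - p] up to constants, hence their average [N / 2]. *)
Lemma levels_embedding : exists (T : 'I_n.+1 -> Type) (dT : forall a, T a -> T a -> R)
  (f : Z * nat -> forall a, T a) (C : R), 0 <= C /\ (forall a, metric_tree (dT a)) /\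
  forall z k z' k' p, (p <= k)%coq_nat -> (p <= k')%coq_nat ->
    p = O \/ d z z' <= tau p -> p = k \/ p = k' \/ tau (S p) < d z z' ->
    let N := INR k + INR k' - 2 * INR p in
    (forall a, dT a (f (z, k) a) (f (z', k') a) <= N + C) /\
    N / 2 - C <= \big[Rplus/0]_(a < n.+1) dT a (f (z, k) a) (f (z', k') a).
Proof.
set (wa := fun (a : 'I_n.+1) l => w l a).
set (G := fun a => overlap d tau (wa a)).
assert (Hbd : forall a l z, 0 <= wa a l z <= 1) by (intros; apply (Hlayer l)).
assert (Hlip : forall a l z z', wa a l z <= wa a l z' + d z z' / (delta / 4 * tau l)).
{ intros; apply (Hlayer l). }
assert (HG : forall a, ultra_product (G a)) by (intros a; apply overlap_ultra; auto).
pose (tr := fun a => constructive_indefinite_description _ (tree_of_ultra_product (G a) (HG a))).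
exists (fun a => proj1_sig (tr a)).
pose (tr2 := fun a => constructive_indefinite_description _ (proj2_sig (tr a))).
exists (fun a => proj1_sig (tr2 a)).
pose (tr3 := fun a => constructive_indefinite_description _ (proj2_sig (tr2 a))).
exists (fun x a => proj1_sig (tr3 a) x).
assert (Htr : forall a, metric_tree (proj1_sig (tr2 a)) /\ forall x y,
   proj1_sig (tr2 a) (proj1_sig (tr3 a) x) (proj1_sig (tr3 a) y) = ultra_dist (G a) x y).
{ intros a. exact (proj2_sig (tr3 a)). }
set (C := 12 / delta).
assert (HC : 0 < C) by (apply Rdiv_lt_0_compat; lra).
set (K := INR n.+1). assert (HK : 1 <= K) by (unfold K; rewrite S_INR; pose proof (pos_INR n); lra).
exists (K * C + 2). split; [nra|]. split; [intros a; apply Htr|].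
intros z k z' k' p Hpk Hpk' Hp Hor N.
set (D := fun a => ultra_dist (G a) (z, k) (z', k')).
replace (\big[Rplus/0]_(a < n.+1) _) with (\big[Rplus/0]_(a < n.+1) D a).
2:{ apply eq_bigr => a _. symmetry; apply Htr. }
split.
- intros a. rewrite (proj2 (Htr a)).
  pose proof (overlap_near d tau delta (wa a) Hd delta_gt0 tau_gt0 tau_eighth (Hbd a) (Hlip a)
    z k z' k' p Hpk Hpk' Hp) as H. fold (G a) in H.
  assert (8 / delta <= C) by (apply Rmult_le_compat_r; [left; apply Rinv_0_lt_compat|]; lra).
  unfold N; nra.
- assert (Hd0 : forall a, 0 <= D a).
  { intros a. unfold D. rewrite -(proj2 (Htr a)). apply (proj1 (proj1 (proj1 (Htr a)))). }
  assert (Hsym : forall a, D a = ultra_dist (G a) (z', k') (z, k)).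
  { intros a. unfold D. rewrite -!(proj2 (Htr a)). apply (proj1 (proj2 (proj2 (proj1 (proj1 (Htr a)))))). }
  assert (Hnn : 0 <= \big[Rplus/0]_(a < n.+1) D a) by (apply sumR_ge0; exact Hd0).
  assert (HKC : 0 < K * C) by nra.
  (* Summing height minus overlap over the colors counts the levels between [j] and [i]. For [i < j]
     the left side is negative. *)
  assert (Hone : forall u i u' i' j,
    (forall a, G a (u, i) (u', i') <= height (wa a) u j + C) ->
    0 <= \big[Rplus/0]_(a < n.+1) ultra_dist (G a) (u, i) (u', i') ->
    INR i - INR j - K * C <= \big[Rplus/0]_(a < n.+1) ultra_dist (G a) (u, i) (u', i')).
  { intros u i u' i' j H H0.
    destruct (Nat.le_gt_cases j i) as [Hji|Hji]; [|apply lt_INR in Hji; lra].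
    pose proof (sum_height_ge n.+1 w u j i (fun l a => proj1 (Hbd a l u))
      (fun l => layer_cover (Hlayer l) u) Hji) as H1.
    assert (H2 : \big[Rplus/0]_(a < n.+1) height (fun l => w l a) u i <=
      \big[Rplus/0]_(a < n.+1) (ultra_dist (G a) (u, i) (u', i') + (height (fun l => w l a) u j + C))).
    { apply sumR_le => a.
      pose proof (ultra_dist_overlap_ge d tau (wa a) Hd (Hbd a) u i u' i') as H2.
      specialize (H a).
      change (height (fun l => w l a) u i - G a (u, i) (u', i') <= ultra_dist (G a) (u, i) (u', i')) in H2.
      change (G a (u, i) (u', i') <= height (fun l => w l a) u j + C) in H. lra. }
    rewrite (sumR_plus (fun a => ultra_dist (G a) _ _)) sumR_plus sumR_const in H2. fold K in H2. lra. }
  assert (Esum : \big[Rplus/0]_(a < n.+1) D a =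
     \big[Rplus/0]_(a < n.+1) ultra_dist (G a) (z', k') (z, k)) by (apply eq_bigr => a _; apply Hsym).
  assert (dsym : d z' z = d z z') by apply (proj1 (proj2 (proj2 Hd))).
  destruct Hor as [E|[E|Hfar]].
  + subst p. assert (H : INR k' - INR k - K * C <= \big[Rplus/0]_(a < n.+1) D a).
    { rewrite Esum. apply Hone; [|rewrite -Esum; exact Hnn].
      intros a. apply (overlap_radial d tau delta (wa a)); auto. rewrite dsym; tauto. }
    apply le_INR in Hpk'. unfold N; lra.
  + subst p. assert (H : INR k - INR k' - K * C <= \big[Rplus/0]_(a < n.+1) D a).
    { apply Hone; [|exact Hnn].
      intros a. apply (overlap_radial d tau delta (wa a)); auto. }
    apply le_INR in Hpk. unfold N; lra.
  (* Going one scale further gains the factor 2 required by [overlap_far], at the price of the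
     additive constant 2. *)
  + assert (Hfar2 : 2 * tau (S (S p)) < d z z').
    { pose proof (tau_eighth (S p)). pose proof (tau_gt0 (S p)). lra. }
    assert (Hfar_le : forall a u i u' i' j, 2 * tau j < d u u' ->
       G a (u, i) (u', i') <= height (wa a) u j + C).
    { intros a. apply (overlap_far d tau delta (fun l => same l a) (wa a)); auto; intros l.
      - apply (layer_near (Hlayer l)).
      - apply (layer_trans (Hlayer l)).
      - apply (layer_small (Hlayer l)). }
    assert (H1 : INR k - INR (S (S p)) - K * C <= \big[Rplus/0]_(a < n.+1) D a).
    { apply Hone; [|exact Hnn]. intros a. apply Hfar_le, Hfar2. }
    assert (H2 : INR k' - INR (S (S p)) - K * C <= \big[Rplus/0]_(a < n.+1) D a).
    { rewrite Esum. apply Hone; [|rewrite -Esum; exact Hnn]. intros a. apply Hfar_le. rewrite dsym; exact Hfar2. }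
    rewrite !S_INR in H1 H2. unfold N; lra.
Qed.
End Embedding.

(** Serves as target when [Z] is empty and the cone is reduced to its apex. *)
Lemma unit_metric_tree : metric_tree (fun _ _ : unit => 0).
Proof.
apply metric_tree_of_four_point.
- split; [|split; [|split]]; try (intros; lra). intros [] []; split; auto.
- intros u v w p. rewrite Rmax_left; lra.
- intros [] []. exists (fun _ => tt). split; [|split]; auto.
  intros s t Hs Ht. replace (s - t) with 0 by lra. rewrite Rabs_R0; reflexivity.
Qed.

(** If the diameter is not positive, all distances vanish; the angle is then 0 whatever
    [PI / diam d] means, and [mu = 1] will do. *)
Lemma cone_angle {Z : Type} (d : Z -> Z -> R) : is_metric d -> met_bounded d ->
  exists mu, 0 < mu /\ forall z z', PI / diam d * d z z' = mu * d z z' /\ 0 <= mu * d z z' <= PI.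
Proof.
intros [Hpos _] Hbd. pose proof PI_RGT_0 as HPI.
destruct (Rlt_or_le 0 (diam d)) as [Hdiam|Hdiam].
- assert (Hmu : 0 < PI / diam d) by (apply Rdiv_lt_0_compat; lra).
  exists (PI / diam d). split; [exact Hmu|]. intros z z'; split; [reflexivity|].
  pose proof (dist_le_diam d z z' Hbd) as H. pose proof (Hpos z z'). split; [nra|].
  apply Rle_trans with (PI / diam d * diam d); [nra|right; field; lra].
- exists 1. split; [lra|]. intros z z'. pose proof (dist_le_diam d z z' Hbd). pose proof (Hpos z z').
  assert (E : d z z' = 0) by lra. rewrite E. lra.
Qed.

Theorem theorem3p1 (Z : Type) (d : Z -> Z -> R) (n : nat) :
  is_metric d -> met_bounded d -> cdim_eq d n ->
  exists (T : 'I_n.+1 -> Type) (dT : forall a, T a -> T a -> R),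
    (forall a, metric_tree (dT a)) /\
    exists f : cone Z -> (forall a, T a),
      qi_embedding (cone_dist d) (prod_dist T dT) f.
Proof.
intros Hd Hbd [Hdim _].
destruct (classic (exists z : Z, True)) as [[z0 _]|Hempty].
2:{ exists (fun _ => unit), (fun _ _ _ => 0). split; [intros _; apply unit_metric_tree|].
  exists (fun _ _ => tt).
  apply qi_of_comparison with (lam := 1) (C1 := 0) (C2 := 0) (C3 := 0); try lra; [intros; lra|].
  intros [[z t]|] x'; [exfalso; apply Hempty; exists z; exact I|].
  destruct x' as [[z t]|]; [exfalso; apply Hempty; exists z; exact I|].
  exists 0. split; [lra|]. split; [intros; lra|].
  split; [rewrite sumR_const; lra|]. simpl. apply Rabs_le; lra. }
destruct (layer_exists d n Hd Hdim) as [delta [Hdelta [tau0 [Htau0 Hlay]]]].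
set (r := Rmin (1 / 8) (delta / 32)).
assert (Hr : 0 < r /\ r <= 1 / 8 /\ r <= delta / 32).
{ split; [|split; [apply Rmin_l|apply Rmin_r]]. apply Rmin_case; lra. }
(* With this [lam], [tau l] is [tau0 * e^(- lam l)]: one level corresponds to radial length [lam],
   and radius [t] goes to the level given by the integer part of [t / lam]. *)
set (lam := - ln r).
assert (Hlam : 0 < lam).
{ unfold lam. assert (ln r < ln 1) by (apply ln_increasing; lra). rewrite ln_1 in H. lra. }
assert (Hexp : exp (- lam) = r) by (unfold lam; rewrite Ropp_involutive exp_ln; lra).
set (tau := fun l => tau0 * exp (- (lam * INR l))).
assert (HtauS : forall l, tau (S l) = r * tau l).
{ intros l. unfold tau. rewrite -Hexp S_INR.
  replace (- (lam * (INR l + 1))) with (- lam + - (lam * INR l)) by lra. rewrite exp_plus. ring. }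
assert (Htau : forall l, 0 < tau l).
{ intros l. apply Rmult_lt_0_compat; [exact Htau0|apply exp_pos]. }
assert (Htau1 : forall l, tau l <= tau0).
{ intros l. unfold tau. rewrite -{2}(Rmult_1_r tau0). apply Rmult_le_compat_l; [lra|].
  rewrite -exp_0. apply exp_le_compat. pose proof (pos_INR l); nra. }
pose (lay := fun l => constructive_indefinite_description _ (Hlay (tau l) (conj (Htau l) (Htau1 l)))).
destruct (levels_embedding d n delta tau (fun l => fst (proj1_sig (lay l)))
  (fun l => snd (proj1_sig (lay l))) Hd Hdelta Htau) as [T [dT [f [C [HC [Htree Hf]]]]]].
{ intros l. rewrite HtauS. pose proof (Htau l); nra. }
{ intros l. rewrite HtauS. pose proof (Htau l); nra. }
{ intros l. exact (proj2_sig (lay l)). }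
exists T, dT. split; [exact Htree|].
assert (Hfloor : forall t : posR, exists k, lam * INR k <= proj1_sig t < lam * INR k + lam).
{ intros [t Ht]; simpl.
  destruct (nat_floor (t / lam)) as [k Hk]; [apply Rdiv_le_0_compat; lra|].
  exists k. assert (E : t = lam * (t / lam)) by (field; lra). nra. }
pose (fl := fun t => constructive_indefinite_description _ (Hfloor t)).
set (lev := fun t => proj1_sig (fl t)).
assert (Hlev : forall t, lam * INR (lev t) <= proj1_sig t < lam * INR (lev t) + lam).
{ intros t. exact (proj2_sig (fl t)). }
destruct (cone_angle d Hd Hbd) as [mu [Hmu Hangle]].
pose proof Hbd as [M HM].
assert (HM0 : 0 <= M) by (apply Rle_trans with (2 := HM z0 z0); apply (proj1 Hd)).
(* To be used with [q = lam * INR p]. Then [d z z'] is at most [tau0 * e^(-q)], or at most [M] if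
   [p] is 0; separation at the next scale gives [d z z' > r * tau0 * e^(-q)]. Rounding a radius to
   its level loses less than [lam]. *)
destruct (hyp_side_estimate (mu * (tau0 + M)) (mu * (tau0 * r)) lam) as [Ch [HCh Hhyp]].
{ repeat apply Rmult_lt_0_compat; lra. }
{ lra. }
exists (fun x => f (match x with None => (z0, O) | Some (z, t) => (z, lev t) end)).
(* The summand [2 * lam] pays for rounding two radii. *)
apply qi_of_comparison with (lam := lam) (C1 := C) (C2 := C) (C3 := Ch + 2 * lam); try lra.
{ intros a u v. apply (proj1 (proj1 (Htree a))). }
(* The apex plays the role of the level 0, which all points share. *)
assert (H0 : forall z k z' k' D, (k = O \/ k' = O) -> Rabs (D - lam * (INR k + INR k')) <= lam ->
  exists N, 0 <= N /\ (forall a, dT a (f (z, k) a) (f (z', k') a) <= N + C) /\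
     N / 2 - C <= \big[Rplus/0]_(a < n.+1) dT a (f (z, k) a) (f (z', k') a) /\
     Rabs (D - lam * N) <= Ch + 2 * lam).
{ intros z k z' k' D H0 HD. exists (INR k + INR k' - 2 * INR 0).
  pose proof (pos_INR k) as Hk; pose proof (pos_INR k') as Hk'. simpl INR. rewrite Rmult_0_r Rminus_0_r.
  destruct (Hf z k z' k' O ltac:(lia) ltac:(lia) ltac:(auto) ltac:(destruct H0; auto)) as [H1 H2].
  simpl INR in H1, H2. rewrite Rmult_0_r Rminus_0_r in H1, H2.
  repeat split; auto; lra. }
intros [[z t]|] [[z' t']|].
- simpl. destruct (meeting_level tau (d z z') (Nat.min (lev t) (lev t'))) as [p [Hp1 [Hp2 Hp3]]].
  assert (Hp4 : p = lev t \/ p = lev t' \/ tau (S p) < d z z').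
  { destruct Hp3 as [->|Hp3]; [|auto].
    destruct (Nat.min_spec (lev t) (lev t')) as [[_ E]|[_ E]]; rewrite E; auto. }
  destruct (Hf z (lev t) z' (lev t') p ltac:(lia) ltac:(lia) Hp2 Hp4) as [H1 H2].
  exists (INR (lev t) + INR (lev t') - 2 * INR p).
  assert (Hpt : INR p <= INR (lev t)) by (apply le_INR; lia).
  assert (Hpt' : INR p <= INR (lev t')) by (apply le_INR; lia).
  split; [lra|]. split; [exact H1|]. split; [exact H2|].
  destruct (Hangle z z') as [-> Hth].
  pose proof (Hlev t) as Ht. pose proof (Hlev t') as Ht'. pose proof (pos_INR p).
  assert (HD : Rabs (hyp_side (proj1_sig t) (proj1_sig t') (mu * d z z') -
     (proj1_sig t + proj1_sig t' - 2 * (lam * INR p))) <= Ch).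
  { apply Hhyp; [exact (proj2_sig t)|exact (proj2_sig t')|exact Hth|nra|nra|nra| |].
    - pose proof (exp_pos (- (lam * INR p))). rewrite Rmult_assoc. apply Rmult_le_compat_l; [lra|].
      destruct Hp2 as [->|Hp2]; [|unfold tau in Hp2; nra].
      simpl. rewrite Rmult_0_r Ropp_0 exp_0. pose proof (HM z z'); lra.
    - destruct Hp4 as [->|[->|Hp4]]; [right; left; lra|right; right; lra|left].
      rewrite HtauS in Hp4. unfold tau in Hp4. nra. }
  apply Rabs_le_between in HD. apply Rabs_le. lra.
- simpl. apply H0; [auto|]. pose proof (Hlev t). apply Rabs_le; simpl; lra.
- simpl. apply H0; [auto|]. pose proof (Hlev t'). apply Rabs_le; simpl; lra.
- simpl. apply H0; [auto|]. apply Rabs_le; simpl; lra.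
Qed.
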